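(* Let $p\ge 2$ be an integer. Then for every $T\in\Gamma_p$, $$ABS(T)\ \ge\ p\sqrt{\frac{p-1}{p+1}},$$ with equality if and only if $T\cong S_{p+1}$.
   Context: For a graph $G$, $d_u$ denotes the degree of the vertex $u$ in $G$, $E(G)$ denotes the set of edges of $G$, and the atom-bond sum-connectivity (ABS) index is $$ABS(G)=\sum_{uv\in E(G)}\sqrt{1-\frac{2}{d_u+d_v}}.$$ A pendent vertex of a tree is a vertex of degree one. For a positive integer $p$, $\Gamma_p$ denotes the class of all trees with $p$ pendent vertices. $S_{p+1}$ denotes the star on $p+1$ vertices (one vertex of degree $p$ adjacent to $p$ pendent vertices).
   Formalization: The tree T is assumed to have at least three vertices: the single edge K_2 lies in Γ_2 but has ABS(K_2) = 0 < 2√(1/3), so the claim fails for it; no other tree is excluded. *)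

(* Defs.v *)
From mathcomp Require Import all_boot all_order all_algebra.

Set Implicit Arguments.
Unset Strict Implicit.
Unset Printing Implicit Defensive.

Import Order.TTheory GRing.Theory Num.Theory.

Local Open Scope ring_scope.

Record sgraph := SGraph {
  vertex :> finType;
  adj : rel vertex;
  adj_sym : symmetric adj;
  adj_irrefl : irreflexive adj }.

Definition deg (G : sgraph) (u : G) : nat := #|[set v | adj u v]|.

Definition edges (G : sgraph) : {set {set G}} :=
  [set e : {set G} | [exists u, exists v, adj u v && (e == [set u; v])]].

(* As an edge is the two-element set of its ends, the inner sum is d_u + d_v. *)
Definition ABS (R : rcfType) (G : sgraph) : R :=
  \sum_(uv in edges G) Num.sqrt (1 - 2 / (\sum_(w in uv) deg w)%N%:R).

Definition connected (G : sgraph) : Prop :=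
  (0 < #|G|)%N /\ forall x y : G, connect (@adj G) x y.

(* The size bound is needed because ucycle accepts [:: u; v] for an edge uv,
   as well as the empty sequence. *)
Definition acyclic (G : sgraph) : Prop :=
  forall c : seq G, (2 < size c)%N -> ~ ucycle (@adj G) c.

Definition tree (G : sgraph) : Prop := connected G /\ acyclic G.

Definition pendent (G : sgraph) : {set G} := [set v | deg v == 1%N].

Definition Gamma (p : nat) (G : sgraph) : Prop :=
  tree G /\ #|pendent G| = p.

Definition star_adj (p : nat) : rel 'I_p.+1 :=
  fun x y => (x == ord0) (+) (y == ord0).

Fact star_adj_sym p : symmetric (@star_adj p).
Proof. by move=> x y; rewrite /star_adj addbC. Qed.

Fact star_adj_irrefl p : irreflexive (@star_adj p).
Proof. by move=> x; rewrite /star_adj addbb. Qed.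

(* star p has p + 1 vertices and centre ord0. *)
Definition star (p : nat) : sgraph :=
  SGraph (@star_adj_sym p) (@star_adj_irrefl p).

Definition isomorphic (G H : sgraph) : Prop :=
  exists2 f : G -> H, bijective f & {mono f : x y / adj x y}.

(* Main.v *)
Require Import Defs.
From mathcomp Require Import all_boot all_order all_algebra.
From mathcomp Require Import perm ring lra zify.
Import Order.TTheory GRing.Theory Num.Theory.
Local Open Scope ring_scope.

(** Write n for the number of vertices, p for the number of pendent vertices and
    I for the set of the n - p other (internal) vertices; I is nonempty as soon
    as n > 2. The n - 1 edges of a tree would contribute n - 1 to ABS if every
    weight were 1, so the question is how much is lost in total.

    Let w(s) = sqrt (1 - 2/s), an increasing function. An edge from a pendent
    vertex to an internal vertex of degree d loses 1 - w(d + 1). An edge between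
    two internal vertices has a larger degree sum, so it loses at most what a
    pendent edge at either end would lose. Charging every loss to the internal
    ends thus costs an internal vertex of degree d at most
    h(d) = d (1 - w(d + 1)), which is the total loss of a star with d leaves
    ([star_loss]), and [ABS_ge] follows:
    ABS(T) >= (n - 1) - sum of h(deg v) over v in I.

    With g = w(d + 1) one has h(d) = (1 + g^2) / (1 + g) ([star_lossE]), from
    which h is nondecreasing and less than 1 for d >= 2. Moreover the handshake
    lemma for trees gives deg v <= p for all v in I ([internal_deg_le]). Bound
    one of the terms h(deg v) by h(p) and each of the |I| - 1 others by 1: the
    right-hand side is at least p - h(p) = p w(p + 1), which is the value for
    the star, and strictly more when |I| >= 2 ([ABS_gt]). When |I| = 1 all edges
    are pendent, nothing was lost in the estimates ([ABS_one_internal]), and the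
    tree is a star ([one_internal_star]). *)

(** * Connected graphs *)

Lemma adj_neq (G : sgraph) (u v : G) : adj u v -> u != v.
Proof. by move=> uv; apply/eqP => E; move: uv; rewrite E adj_irrefl. Qed.

(** Used with one vertex (no isolated vertices) and with two adjacent leaves
    (their edge would be a whole component). *)
Lemma connected_closed (G : sgraph) (A : {set G}) (x : G) :
  connected G -> x \in A ->
  (forall u v, u \in A -> adj u v -> v \in A) -> A = [set: G].
Proof.
move=> [_ conG] xA clA; apply/setP => y; rewrite inE.
have /connectP[q xq ->] := conG x y.
elim: q x xA xq => [|z q IHq] x xA //= /andP[xz zq].
exact: IHq (clA _ _ xA xz) zq.
Qed.

Lemma deg_gt0 (G : sgraph) (u : G) : connected G -> (1 < #|G|)%N ->
  (0 < deg u)%N.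
Proof.
move=> conG n1; rewrite lt0n; apply/eqP => /eqP; rewrite cards_eq0 => /eqP d0.
have A1 : [set u] = [set: G].
  apply: (connected_closed _ _ _ conG (set11 u)).
  move=> x y /set1P-> uy.
  by have := in_set0 y; rewrite -d0 inE uy.
by move: n1; rewrite -cardsT -A1 cards1.
Qed.

Lemma deg1_adj (G : sgraph) (u v w : G) :
  deg u = 1%N -> adj u v -> adj u w -> w = v.
Proof.
move=> /eqP/cards1P[z uz] uv uw.
have /set1P-> : v \in [set z] by rewrite -uz inE.
by have /set1P-> : w \in [set z] by rewrite -uz inE.
Qed.

Lemma adj_pendent (G : sgraph) (u v : G) : connected G -> (2 < #|G|)%N ->
  adj u v -> u \in pendent G -> v \notin pendent G.
Proof.
move=> conG n2 uv; rewrite !inE => /eqP du; apply/eqP => dv.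
have A2 : [set u; v] = [set: G].
  apply: (connected_closed _ _ _ conG (set21 u v)).
  move=> x y /set2P[] -> xy.
    by rewrite (deg1_adj _ _ _ _ du uv xy) set22.
  by rewrite adj_sym in uv; rewrite (deg1_adj _ _ _ _ dv uv xy) set21.
by move: n2; rewrite -cardsT -A2 cards2 (adj_neq _ _ _ uv).
Qed.

(** * Trees have one edge fewer than vertices *)

(** The level of x is its distance to r, and its parent is the last but one
    vertex of a shortest walk from r to x. *)
Lemma parent_exists (G : sgraph) (r : G) : connected G ->
  exists (pa : G -> G) (level : G -> nat),
    forall x, x != r -> adj x (pa x) && (level (pa x) < level x)%N.
Proof.
move=> [_ conG].
pose walk x n := [exists q : n.-tuple G, path (@adj G) r q && (last r q == x)].
have walkP x q : path (@adj G) r q -> last r q = x -> walk x (size q).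
  by move=> rq rx; apply/existsP; exists (in_tuple q); rewrite rq /= rx eqxx.
have ex_walk x : exists n, walk x n.
  have /connectP[q rq ->] := conG r x.
  by exists (size q); apply: walkP.
pose level x := ex_minn (ex_walk x).
have closer x : exists y, (x != r) ==> adj x y && (level y < level x)%N.
  have [->|xr] := eqVneq x r; first by exists r.
  rewrite {2}/level; case: ex_minnP => n /existsP[q /andP[rq /eqP rx]] _.
  case/lastP: {q}(tval q) (size_tuple q) rq rx => [|q y] /= sz rq rx.
    by rewrite rx eqxx in xr.
  move: rq; rewrite rcons_path last_rcons in rx * => /andP[rq qy].
  exists (last r q); rewrite -rx adj_sym qy /=.
  rewrite -sz size_rcons ltnS /level.
  by case: ex_minnP => m _; apply; apply: walkP.
have [pa paP] := fin_all_exists closer.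
by exists pa, level => x xr; have := paP x; rewrite xr.
Qed.

(** Orient the tree towards a root r. The edges from a vertex to its parent
    already connect everything, so a further edge would close a cycle with the
    path of parent edges between its ends. Hence each edge is the parent edge of
    exactly one vertex other than r, and it is counted at both ends. *)
Lemma tree_sum_deg (G : sgraph) : tree G ->
  (\sum_(u : G) deg u = (#|G|.-1).*2)%N.
Proof.
move=> [conG acG]; have [/card_gt0P[r _] _] := conG.
have [pa [level paP]] := parent_exists _ r conG.
pose up u v := (u != r) && (pa u == v).
pose e u v := up u v || up v u.
have e_sym : symmetric e by move=> u v; rewrite /e orbC.
have up_adj u v : up u v -> adj u v.
  by move=> /andP[/paP/andP[? _] /eqP<-].
have e_adj : subrel e (@adj G).
  by move=> u v /orP[/up_adj|/up_adj] //; rewrite adj_sym.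
have e_root x : connect e x r.
  have [m] := ubnP (level x); elim: m x => // m IHm x; rewrite ltnS => lex.
  have [->|xr] := eqVneq x r; first exact: connect0.
  have /andP[_ lt] := paP _ xr.
  apply: connect_trans (IHm (pa x) (leq_trans lt lex)).
  by apply: connect1; rewrite /e /up xr eqxx.
have e_conn u v : connect e u v.
  by apply: connect_trans (e_root u) _; rewrite (sym_connect_sym e_sym).
have adjE u v : adj u v = e u v.
  apply/idP/idP => [uv|/e_adj//]; apply/negPn/negP => Neuv.
  (* A simple e-path u :: q from u to v, closed by the edge uv, is a cycle. *)
  have /connectP[q0 uq0 vq0] := e_conn u v.
  case/shortenP: uq0 vq0 => q uq Uq _ vq.
  apply: (acG (u :: q)).
    case: q uq vq {Uq} => [|a [|b q]] //= uq vq.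
      by move: uv; rewrite vq adj_irrefl.
    by move: uq Neuv; rewrite -vq andbT => ->.
  rewrite /ucycle Uq andbT /= rcons_path (sub_path e_adj uq) /=.
  by rewrite -vq adj_sym.
(* No edge is the parent edge of both its ends, since levels would decrease
   both ways. *)
have upN u v : up u v -> up v u = false.
  move=> /andP[/paP/andP[_ lu] /eqP Eu]; apply/negP=> /andP[/paP/andP[_ lv]].
  by move=> /eqP Ev; move: lu lv; rewrite Eu Ev; lia.
have sum_up : (\sum_u \sum_v up u v = #|G|.-1)%N.
  rewrite -(cardC1 r) -sum1_card [RHS]big_mkcond /=; apply: eq_bigr => u _.
  rewrite (bigD1 (pa u)) //= big1 ?addn0.
    by rewrite /up eqxx andbT inE; case: eqP.
  by move=> v; rewrite eq_sym /up => /negPf->; rewrite andbF.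
rewrite -addnn -{1}sum_up -sum_up [X in (_ = _ + X)%N]exchange_big -big_split /=.
apply: eq_bigr => u _; rewrite -big_split /= /deg -sum1_card big_mkcond /=.
apply: eq_bigr => v _; rewrite inE adjE /e.
by case: (boolP (up u v)) => [/upN->|]; case: (up v u).
Qed.

(** * Sums over edges as sums over ordered pairs of adjacent vertices *)

(** Ordered pairs let a quantity attached to the ends of edges be summed vertex
    by vertex. *)
Lemma sum_edges (V : nmodType) (G : sgraph) (F : {set G} -> V) :
  (\sum_(e in edges G) F e) *+ 2 = \sum_u \sum_(v | adj u v) F [set u; v].
Proof.
rewrite pair_big_dep /=.
rewrite (partition_big (fun p : G * G => [set p.1; p.2]) (mem (edges G))) /=.
  rewrite -sumrMnl; apply: eq_bigr => e.
  rewrite inE => /existsP[u /existsP[v /andP[uv /eqP->]]].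
  have uv' := adj_neq _ _ _ uv.
  rewrite (eq_bigl (mem [set (u, v); (v, u)])) /=.
    rewrite big_setU1 ?big_set1 /= ?[[set v; u]]setUC ?mulr2n //.
    by rewrite inE xpair_eqE negb_and uv'.
  move=> [a b] /=; rewrite !inE !xpair_eqE.
  apply/andP/orP => [[ab /eqP E]|[]/andP[/eqP-> /eqP->]]; first last.
  - by rewrite adj_sym uv setUC.
  - by rewrite uv.
  have /set2P[] : a \in [set u; v] by rewrite -E set21.
    have /set2P[] : b \in [set u; v] by rewrite -E set22.
      by move=> bu au; move: ab; rewrite au bu adj_irrefl.
    by move=> -> ->; left; rewrite !eqxx.
  have /set2P[] : b \in [set u; v] by rewrite -E set22.
    by move=> -> ->; right; rewrite !eqxx.
  by move=> bu au; move: ab; rewrite au bu adj_irrefl.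
move=> [u v] /= uv; rewrite inE; apply/existsP; exists u.
by apply/existsP; exists v; rewrite uv eqxx.
Qed.

(** * The weight of an edge and the loss of a star *)

Definition weight (R : rcfType) (s : nat) : R := Num.sqrt (1 - 2 / s%:R).

(** The deficit d - ABS of the star with d leaves, with respect to d edges of
    weight 1. *)
Definition star_loss (R : rcfType) (d : nat) : R :=
  d%:R * (1 - weight R d.+1).

Lemma weight_le (R : rcfType) (s t : nat) :
  (0 < s)%N -> (s <= t)%N -> weight R s <= weight R t.
Proof.
move=> s0 st; apply: ler_wsqrtr; rewrite lerD2l lerN2 ler_wpM2l //.
by rewrite lef_pV2 ?posrE ?ltr0n ?ler_nat ?(leq_trans s0).
Qed.

Lemma weight_ge0 (R : rcfType) (s : nat) : 0 <= weight R s.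
Proof. exact: sqrtr_ge0. Qed.

Lemma weight_lt1 (R : rcfType) (s : nat) : (0 < s)%N -> weight R s < 1.
Proof.
move=> s0; rewrite -[ltRHS]sqrtr1 ltr_sqrt ?ltr01 // gtrBl.
by rewrite divr_gt0 ?ltr0n.
Qed.

Lemma weightE (R : rcfType) (d : nat) :
  weight R d.+1 = Num.sqrt ((d%:R - 1) / (d%:R + 1)).
Proof.
rewrite /weight -natr1; congr Num.sqrt.
have : (d%:R + 1 : R) != 0 by rewrite natr1 pnatr_eq0.
by move=> d0; field.
Qed.

Lemma weight_sqr (R : rcfType) (d : nat) : (0 < d)%N ->
  (d%:R + 1) * weight R d.+1 ^+ 2 = d%:R - 1.
Proof.
move=> d0; rewrite weightE sqr_sqrtr; last first.
  by rewrite divr_ge0 ?subr_ge0 ?ler1n ?addr_ge0.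
by rewrite mulrC divfK // natr1 pnatr_eq0.
Qed.

(** From g^2 = (d - 1) / (d + 1) one gets d (1 - g^2) = 1 + g^2; dividing by
    1 + g removes d from the formula, so that monotonicity in d becomes
    monotonicity of a rational function of g. *)
Lemma star_lossE (R : rcfType) (d : nat) : (0 < d)%N ->
  star_loss R d = (1 + weight R d.+1 ^+ 2) / (1 + weight R d.+1).
Proof.
move=> d0; have := weight_sqr R d d0; have := weight_ge0 R d.+1.
rewrite /star_loss; move: (weight _ _) => g g0 sq.
have g1 : 1 + g != 0 by rewrite gt_eqF; lra.
by apply: (canRL (mulfK g1)); nra.
Qed.

(** The smallest value is sqrt (1/3). The function (1 + g^2) / (1 + g) increases
    only for g >= sqrt 2 - 1, and 1/2 is a convenient number in between. *)
Lemma weight_ge_half (R : rcfType) (d : nat) : (1 < d)%N ->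
  1 / 2 <= weight R d.+1.
Proof.
move=> d1; apply: le_trans (weight_le R 3 d.+1 isT d1).
by have := weight_sqr R 2 isT; have := weight_ge0 R 3; nra.
Qed.

Lemma star_loss_le (R : rcfType) (d e : nat) : (1 < d)%N -> (d <= e)%N ->
  star_loss R d <= star_loss R e.
Proof.
move=> d1 de; rewrite !star_lossE; [|lia|lia].
have := weight_ge_half R d d1; have := weight_le R d.+1 e.+1 isT de.
move: (weight _ _) (weight _ _) => h g gh g2.
rewrite ler_pdivrMr; last lra; rewrite mulrAC ler_pdivlMr; last lra.
rewrite -subr_ge0.
have -> : (1 + h ^+ 2) * (1 + g) - (1 + g ^+ 2) * (1 + h) =
          (h - g) * (g + h - 1 + g * h) by ring.
by apply: mulr_ge0; nra.
Qed.

Lemma star_loss_lt1 (R : rcfType) (d : nat) : (1 < d)%N -> star_loss R d < 1.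
Proof.
move=> d1; rewrite star_lossE; last lia.
have := weight_ge_half R d d1; have := weight_lt1 R d.+1 isT.
by move: (weight _ _) => g g1 g2; rewrite ltr_pdivrMr; nra.
Qed.

(** * Degrees of the internal vertices of a tree *)

Lemma internal_deg (G : sgraph) (u : G) : connected G -> (2 < #|G|)%N ->
  u \in ~: pendent G -> (1 < deg u)%N.
Proof.
move=> conG n2; rewrite !inE => du.
by have := deg_gt0 G u conG (ltnW n2); move: du; case: (deg u) => [|[|]].
Qed.

Lemma sum_internal_deg (G : sgraph) : tree G ->
  (\sum_(u in ~: pendent G) deg u + #|pendent G| = (#|G|.-1).*2)%N.
Proof.
move=> treeG; rewrite -(tree_sum_deg G treeG) addnC -sum1_card.
rewrite [RHS](bigID (mem (pendent G))) /=; congr addn.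
  by apply: eq_bigr => u; rewrite inE => /eqP->.
by apply: eq_bigl => u; rewrite inE.
Qed.

Lemma internal_exists (G : sgraph) : tree G -> (2 < #|G|)%N ->
  (0 < #|~: pendent G|)%N.
Proof.
move=> treeG n2; rewrite lt0n cards_eq0; apply/eqP => I0.
have := sum_internal_deg G treeG; have := cardsC (pendent G).
by rewrite I0 big_set0 cards0; lia.
Qed.

(** The handshake lemma reads: deg u - 2, summed over the internal vertices u,
    is p - 2. All these terms are nonnegative, so none exceeds p - 2. *)
Lemma internal_deg_le (G : sgraph) (v : G) : tree G -> (2 < #|G|)%N ->
  v \in ~: pendent G -> (deg v <= #|pendent G|)%N.
Proof.
move=> treeG n2 vI.
have := sum_internal_deg G treeG; have := cardsC (pendent G).
rewrite (bigD1 v) //= (cardsD1 v (~: _)) vI.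
have : (\sum_(u in ~: pendent G | u != v) 2 <=
        \sum_(u in ~: pendent G | u != v) deg u)%N.
  by apply: leq_sum => u /andP[uI _]; apply: internal_deg => //; case: treeG.
have -> : (\sum_(u in ~: pendent G | u != v) 2 =
           #|(~: pendent G) :\ v| * 2)%N.
  by rewrite -sum_nat_const; apply: eq_bigl => u; rewrite !inE andbC.
by lia.
Qed.

(** * Charging the losses to the internal vertices *)

Lemma sum_weight_darts (R : rcfType) (G : sgraph) :
  ABS R G *+ 2 =
  \sum_(u : G) \sum_(v | adj u v) weight R (deg u + deg v).
Proof.
rewrite /ABS sum_edges; apply: eq_bigr => u _; apply: eq_bigr => v uv.
by rewrite big_setU1 ?big_set1 // inE (adj_neq _ _ _ uv).
Qed.

(** The share of the loss of an edge that is charged to its end u. *)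
Definition end_loss (R : rcfType) (G : sgraph) (u : G) : R :=
  if u \in ~: pendent G then 1 - weight R (deg u).+1 else 0.

Lemma weight_edge_pendent (R : rcfType) (G : sgraph) (u v : G) :
  connected G -> (2 < #|G|)%N -> adj u v -> u \in pendent G ->
  weight R (deg u + deg v) = 1 - (end_loss R G u + end_loss R G v).
Proof.
move=> conG n2 uv uL; have vI := adj_pendent G u v conG n2 uv uL.
rewrite /end_loss !in_setC uL vI /=; move: uL; rewrite inE => /eqP->.
by rewrite add1n; ring.
Qed.

(** For two internal ends, the charge at u alone covers the loss: the weight is
    monotone and deg v >= 1. *)
Lemma weight_edge_ge (R : rcfType) (G : sgraph) (u v : G) :
  connected G -> (2 < #|G|)%N -> adj u v ->
  1 - (end_loss R G u + end_loss R G v) <= weight R (deg u + deg v).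
Proof.
move=> conG n2 uv; case: (boolP (u \in pendent G)) => uL.
  by rewrite (weight_edge_pendent R G u v).
have uI : u \in ~: pendent G by rewrite inE.
have du := internal_deg G u conG n2 uI.
case: (boolP (v \in pendent G)) => vL.
  by rewrite addnC [_ + end_loss _ _ _]addrC weight_edge_pendent // adj_sym.
have vI : v \in ~: pendent G by rewrite inE.
have dv := internal_deg G v conG n2 vI.
rewrite /end_loss uI vI.
have := weight_lt1 R (deg v).+1 isT.
have : weight R (deg u).+1 <= weight R (deg u + deg v) by apply: weight_le; lia.
by lra.
Qed.

(** An internal vertex of degree d is charged d times, that is star_loss d. *)
Lemma sum_end_loss (R : rcfType) (G : sgraph) : tree G -> (2 < #|G|)%N ->
  \sum_(u : G) \sum_(v | adj u v) (1 - (end_loss R G u + end_loss R G v)) =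
  (#|G|.-1%:R - \sum_(u in ~: pendent G) star_loss R (deg u)) *+ 2.
Proof.
move=> treeG n2.
have sum_deg (F : G -> R) :
    \sum_u \sum_(v | adj u v) F u = \sum_u (deg u)%:R * F u.
  apply: eq_bigr => u _; rewrite sumr_const mulr_natl /deg; congr (_ *+ _).
  by apply: eq_card => v; rewrite !inE.
have loss : \sum_u \sum_(v | adj u v) end_loss R G u =
            \sum_(u in ~: pendent G) star_loss R (deg u).
  rewrite sum_deg [RHS]big_mkcond /=; apply: eq_bigr => u _.
  by rewrite /end_loss; case: ifP; rewrite ?mulr0.
have loss' : \sum_u \sum_(v | adj u v) end_loss R G v =
             \sum_(u in ~: pendent G) star_loss R (deg u).
  rewrite -loss (exchange_big_dep predT) //=.
  by apply: eq_bigr => u _; apply: eq_bigl => v; rewrite adj_sym.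
have darts : \sum_(u : G) \sum_(v | adj u v) (1 : R) = #|G|.-1%:R *+ 2.
  rewrite (sum_deg (fun=> 1)) -mulrnA muln2 -(tree_sum_deg G treeG) natr_sum.
  by apply: eq_bigr => u _; rewrite mulr1.
under eq_bigr => u _ do rewrite sumrB big_split /=.
by rewrite sumrB big_split /= darts loss loss'; ring.
Qed.

Lemma ABS_ge (R : rcfType) (G : sgraph) : tree G -> (2 < #|G|)%N ->
  #|G|.-1%:R - \sum_(u in ~: pendent G) star_loss R (deg u) <= ABS R G.
Proof.
move=> treeG n2; rewrite -(ler_pMn2r (n := 2)) // sum_weight_darts.
rewrite -sum_end_loss //; apply: ler_sum => u _; apply: ler_sum => v uv.
by apply: weight_edge_ge => //; case: treeG.
Qed.

(** * The extremal trees *)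

Lemma edge_one_internal (G : sgraph) (c u v : G) : ~: pendent G = [set c] ->
  adj u v -> (u \in pendent G) || (v \in pendent G).
Proof.
move=> Ic uv; rewrite -[_ || _]negbK negb_or -!in_setC Ic !inE.
by apply/negP => /andP[/eqP uc /eqP vc]; move: uv; rewrite uc vc adj_irrefl.
Qed.

(** With a single internal vertex, every edge has a pendent end, so
    [weight_edge_pendent] turns the estimate of [ABS_ge] into an equality. *)
Lemma ABS_one_internal (R : rcfType) (G : sgraph) (c : G) :
  tree G -> (2 < #|G|)%N -> ~: pendent G = [set c] ->
  ABS R G = #|pendent G|%:R * weight R #|pendent G|.+1.
Proof.
move=> treeG n2 Ic; have := sum_internal_deg G treeG.
have := cardsC (pendent G); rewrite Ic big_set1 cards1 => cardG dc.
have {}dc : deg c = #|pendent G| by lia.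
have -> : ABS R G = #|G|.-1%:R - star_loss R (deg c).
  have -> : star_loss R (deg c) = \sum_(u in ~: pendent G) star_loss R (deg u).
    by rewrite Ic big_set1.
  apply: (@pmulrnI _ 2) => //; rewrite sum_weight_darts -sum_end_loss //.
  apply: eq_bigr => u _; apply: eq_bigr => v uv; have [conG _] := treeG.
  have /orP[uL|vL] := edge_one_internal G c u v Ic uv.
    exact: weight_edge_pendent.
  by rewrite addnC [_ + end_loss _ _ _]addrC weight_edge_pendent // adj_sym.
by rewrite -cardG addn1 dc /= /star_loss; ring.
Qed.

(** One internal vertex is kept to account for h(p); the others cost strictly
    less than 1 each, and there is at least one of them. *)
Lemma ABS_gt (R : rcfType) (G : sgraph) : tree G -> (2 < #|G|)%N ->
  (1 < #|~: pendent G|)%N ->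
  #|pendent G|%:R * weight R #|pendent G|.+1 < ABS R G.
Proof.
move=> treeG n2 I2; apply: lt_le_trans (ABS_ge R G treeG n2).
have [conG _] := treeG.
have /card_gt0P[v vI] := internal_exists G treeG n2.
rewrite (big_setD1 v) //=.
have dv := internal_deg G v conG n2 vI.
have hv := star_loss_le R _ _ dv (internal_deg_le G v treeG n2 vI).
have Jcard := cardsD1 v (~: pendent G); rewrite vI in Jcard.
have hJ : \sum_(u in (~: pendent G) :\ v) star_loss R (deg u) <
          #|(~: pendent G) :\ v|%:R.
  rewrite -sumr_const; apply: ltr_sum => [|u]; last first.
    by case/setD1P => _ uI; apply/star_loss_lt1/internal_deg.
  have /card_gt0P[w wJ] : (0 < #|(~: pendent G) :\ v|)%N by lia.
  by apply/hasP; exists w; rewrite // mem_index_enum.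
have -> : #|G|.-1 = (#|pendent G| + #|(~: pendent G) :\ v|)%N.
  by rewrite -(cardsC (pendent G)) Jcard; lia.
by rewrite natrD; move: hv hJ; rewrite /star_loss; lra.
Qed.

(** A leaf cannot be adjacent to a leaf, so each is adjacent to c. An arbitrary
    numbering of the vertices, followed by the transposition that sends the
    number of c to 0, is then an isomorphism. *)
Lemma one_internal_star (G : sgraph) (c : G) : connected G -> (2 < #|G|)%N ->
  ~: pendent G = [set c] -> isomorphic G (star #|pendent G|).
Proof.
move=> conG n2 Ic; set p := #|pendent G|.
have cardG : #|G| = p.+1 by rewrite -(cardsC (pendent G)) Ic cards1 addn1.
have leaf u : u != c -> u \in pendent G.
  by move=> uc; rewrite -[_ \in _]negbK -in_setC Ic inE.
have cI : c \notin pendent G by rewrite -in_setC Ic set11.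
have leaf_adj u : u != c -> adj u c.
  move=> uc; have /card_gt0P[w] := deg_gt0 G u conG (ltnW n2).
  rewrite inE => uw; have := adj_pendent G u w conG n2 uw (leaf u uc).
  by rewrite -in_setC Ic => /set1P<-.
have adjE u v : adj u v = (u == c) (+) (v == c).
  have [->|uc] := eqVneq u c; have [->|vc] := eqVneq v c => /=.
  - exact: adj_irrefl.
  - by rewrite adj_sym leaf_adj.
  - exact: leaf_adj.
  apply/negP => /(adj_pendent G u v conG n2)/(_ (leaf u uc)).
  by rewrite leaf.
pose rank u : 'I_p.+1 := cast_ord cardG (enum_rank u).
pose f u := tperm ord0 (rank c) (rank u).
have rank_bij : bijective rank.
  apply: bij_comp (enum_rank_bij G).
  by exists (cast_ord (esym cardG)); [exact: cast_ordK|exact: cast_ordKV].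
have f_bij : bijective f by apply: bij_comp rank_bij; apply: injF_bij perm_inj.
have f0 u : (f u == ord0) = (u == c).
  by rewrite -(bij_eq f_bij) {3}/f tpermR.
by exists f => // u v /=; rewrite /star_adj !f0 adjE.
Qed.

Theorem theorem1 (R : rcfType) (p : nat) (hp : (2 <= p)%N)
    (T : sgraph) (hT : Gamma p T) (hK2 : (2 < #|T|)%N) :
  ABS R T >= p%:R * Num.sqrt ((p%:R - 1) / (p%:R + 1)) /\
  (ABS R T = p%:R * Num.sqrt ((p%:R - 1) / (p%:R + 1)) <->
   isomorphic T (star p)).
Proof.
case: hT => treeT <- {p hp}; rewrite -weightE.
have [conT _] := treeT; have I0 := internal_exists T treeT hK2.
have [I1|I1] := leqP #|~: pendent T| 1.
  have /cards1P[c Ic] : #|~: pendent T| == 1%N by rewrite eqn_leq I1.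
  rewrite (ABS_one_internal R T c) // lexx; split => //.
  by split => // _; apply: (one_internal_star T c).
have gt := ABS_gt R T treeT hK2 I1; split; first exact: ltW.
split => [E|[f f_bij _]]; first by rewrite E ltxx in gt.
move: I1; have := cardsC (pendent T).
by have := bij_eq_card f_bij; rewrite card_ord; lia.
Qed.
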